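(* Consider a locally o-minimal structure whose universe is $\mathbb R$ (with its usual order). Let $X$ be a definable set and $f:X\to\mathbb R^n$ a definable map. Then $\dim(f(X))\le\dim(X)$.
   Context: ''Definable'' means definable with parameters. A structure $(\mathbb R,<,\ldots)$ is locally o-minimal if for every definable $X\subset\mathbb R$ and every $a\in\mathbb R$ there is an open interval $I\ni a$ with $X\cap I$ a finite union of points and open intervals. For a nonempty definable set $X\subset\mathbb R^m$, $\dim X$ is the largest $d$ such that there exist an open box $B\subset\mathbb R^d$ and a definable map $B\to X$ which is a homeomorphism onto its image; $\dim\emptyset=-\infty$. *)

(* Defs.v *)
From HB Require Import structures.
From mathcomp Require Import all_boot all_order all_algebra.
From mathcomp Require Import all_classical all_reals all_analysis.

Set Implicit Arguments.
Unset Strict Implicit.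
Unset Printing Implicit Defensive.

Import Order.TTheory GRing.Theory Num.Theory.
Import numFieldNormedType.Exports.

Local Open Scope classical_set_scope.
Local Open Scope ring_scope.

(* The symbols other than [=] and [<], which are built into [formula] below
   and always interpreted by equality and by the usual order. *)
Record language := Language {
  fsym : Type;
  farity : fsym -> nat;
  rsym : Type;
  rarity : rsym -> nat }.

Record structure (R : realType) (L : language) := Structure {
  fint : forall f : fsym L, ('I_(farity f) -> R) -> R;
  rint : forall r : rsym L, ('I_(rarity r) -> R) -> Prop }.

Inductive term (L : language) :=
| Var of nat
| App (f : fsym L) of ('I_(farity f) -> term L).

(* De Bruijn indices: [All p] binds the variable 0 of [p]. *)
Inductive formula (L : language) :=
| Eq of term L & term L
| Lt of term L & term L
| Rel (r : rsym L) of ('I_(rarity r) -> term L)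
| Not of formula L
| And of formula L & formula L
| All of formula L.

Section Definability.
Variables (R : realType) (L : language) (M : structure R L).

Fixpoint eval (e : nat -> R) (t : term L) : R :=
  match t with
  | Var i => e i
  | App f ts => fint M (fun i => eval e (ts i))
  end.

Definition push (x : R) (e : nat -> R) : nat -> R :=
  fun i => if i is j.+1 then e j else x.

Fixpoint sat (e : nat -> R) (p : formula L) : Prop :=
  match p with
  | Eq t u => eval e t = eval e u
  | Lt t u => eval e t < eval e u
  | Rel r ts => rint M (fun i => eval e (ts i))
  | Not q => ~ sat e q
  | And q s => sat e q /\ sat e s
  | All q => forall x : R, sat (push x e) q
  end.

(* The variables below [n] are the coordinates of [x], the other ones stand for
   the parameters [c]; a formula only mentions finitely many of them. *)
Definition env n (x : 'rV[R]_n) (c : nat -> R) : nat -> R :=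
  fun i => if insub i is Some j then x ord0 j else c (i - n)%N.

Definition definable n (X : set 'rV[R]_n) : Prop :=
  exists (p : formula L) (c : nat -> R), X = [set x | sat (env x c) p].

(* A map X -> R^n is given by a function on R^m, of which only the restriction
   to X is relevant. *)
Definition definable_map m n (X : set 'rV[R]_m) (f : 'rV[R]_m -> 'rV[R]_n) :
    Prop :=
  definable [set row_mx x (f x) | x in X].

Definition open_interval (J : set R) : Prop :=
  J !=set0 /\ exists a b : \bar R, J = [set x | (a < x%:E < b)%E].

Definition open_box d (B : set 'rV[R]_d) : Prop :=
  exists J : 'I_d -> set R,
    (forall i, open_interval (J i)) /\
    B = [set x | forall i, J i (x ord0 i)].

(* X is viewed as a subset of 'rV[R]_1. *)
Definition locally_o_minimal : Prop :=
  forall (X : set R), definable [set x : 'rV[R]_1 | X (x ord0 ord0)] ->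
  forall a : R, exists I : set R,
    [/\ open_interval I, I a &
      exists F : set (set R),
        [/\ finite_set F,
          forall J, F J -> (exists x, J = [set x]) \/ open_interval J &
          X `&` I = \bigcup_(J in F) J]].

Definition homeo_onto_image (S T : topologicalType) (A : set S) (f : S -> T) :
    Prop :=
  {within A, continuous f} /\
  exists g : T -> S,
    (forall x, A x -> g (f x) = x) /\ {within f @` A, continuous g}.

Definition embeds_box m (X : set 'rV[R]_m) (d : nat) : Prop :=
  exists (B : set 'rV[R]_d) (f : 'rV[R]_d -> 'rV[R]_m),
    [/\ open_box B, definable_map B f, f @` B `<=` X & homeo_onto_image B f].

(* The supremum is the largest such d whenever there is one (lemma [dimension_max]),
   and is -oo for the empty set (lemma [dimension_set0]). *)
Definition dimension m (X : set 'rV[R]_m) : \bar R :=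
  ereal_sup [set (d%:R : R)%:E | d in [set d : nat | embeds_box X d]].

Lemma dimension_max m (X : set 'rV[R]_m) (d : nat) :
  embeds_box X d -> (forall k, embeds_box X k -> (k <= d)%N) ->
  dimension X = (d%:R : R)%:E.
Proof.
move=> Xd dmax; apply/eqP; rewrite eq_le; apply/andP; split.
  by apply: ge_ereal_sup => _ [k /= Xk <-]; rewrite lee_fin ler_nat dmax.
by apply: ereal_sup_ubound; exists d.
Qed.

Lemma open_box_nonempty d (B : set 'rV[R]_d) : open_box B -> B !=set0.
Proof.
move=> [J [Jint ->]]; have [x Jx] := choice (fun i => (Jint i).1).
by exists (\row_i x i) => i /=; rewrite mxE.
Qed.

Lemma dimension_set0 m : dimension (set0 : set 'rV[R]_m) = -oo%E.
Proof.
rewrite /dimension (_ : [set d | _] = set0) ?image_set0 ?ereal_sup0 //.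
rewrite -subset0 => d [B [f [/open_box_nonempty [x Bx] _ fB _]]].
by apply: (fB (f x)); exists x.
Qed.

End Definability.

(* Main.v *)
Require Import Defs.
From mathcomp Require Import all_boot all_order all_algebra.
From mathcomp Require Import all_classical all_reals all_analysis.

Set Implicit Arguments.
Unset Strict Implicit.
Unset Printing Implicit Defensive.

Import Order.TTheory GRing.Theory Num.Theory.
Import numFieldNormedType.Exports.

Local Open Scope classical_set_scope.
Local Open Scope ring_scope.

(* In a locally o-minimal structure on the reals, a definable subset of the line
   without interior is discrete, hence countable. By induction on the dimension,
   if countably many definable sets cover a box, then one of them has interior.
   Let a box of dimension d embed into f(X). It is then the image of a definable
   subset of X under a definable map, and the graph Z of this map projects onto
   the box. The covering property gives an exchange principle: in a set of d
   coordinates onto which Z has a projection with interior, the coordinates of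
   the box can be replaced one by one by coordinates of X, for otherwise the
   fibers of Z would be countable. Hence X has a projection with interior to d of
   its coordinates. The other coordinates can be made, one at a time, continuous
   functions of these d on a smaller box: by the covering property, over some box
   the fibers contain a fixed interval or have a unique point in a fixed rational
   interval, and a definable function is continuous on some box, because its
   discontinuities lie in the countably many sets A \ int A, where A is the
   preimage of a rational interval. *)

(** * Renaming of variables in first-order formulas *)

Section Renaming.
Variables (R : realType) (L : language) (M : structure R L).

Fixpoint rename_term (h : nat -> nat) (t : term L) : term L :=
  match t with
  | Var i => Var L (h i)
  | App f ts => App (fun i => rename_term h (ts i))
  end.

Definition lift_renaming (h : nat -> nat) (i : nat) : nat :=
  if i is j.+1 then (h j).+1 else 0%N.

Fixpoint rename (h : nat -> nat) (p : formula L) : formula L :=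
  match p with
  | Eq t u => Eq (rename_term h t) (rename_term h u)
  | Lt t u => Lt (rename_term h t) (rename_term h u)
  | Rel r ts => Rel (fun i => rename_term h (ts i))
  | Not q => Not (rename h q)
  | And q s => And (rename h q) (rename h s)
  | All q => All (rename (lift_renaming h) q)
  end.

Lemma eval_rename h e (t : term L) :
  Defs.eval M e (rename_term h t) = Defs.eval M (e \o h) t.
Proof.
by elim: t => //= f ts IH; congr (fint M _); apply/funext => i; exact: IH.
Qed.

Lemma sat_rename h e (p : formula L) :
  sat M e (rename h p) <-> sat M (e \o h) p.
Proof.
elim: p h e => [t u|t u|r ts|q IH|q IHq s IHs|q IH] h e /=.
- by rewrite !eval_rename.
- by rewrite !eval_rename.
- rewrite (_ : (fun i => _) = fun i => Defs.eval M (e \o h) (ts i)) //.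
  by apply/funext => i; rewrite eval_rename.
- by split=> nq /IH.
- by split=> -[/IHq ? /IHs].
- have pushE x : push x e \o lift_renaming h = push x (e \o h).
    by apply/funext => -[].
  by split=> all_q x; have := all_q x; rewrite IH pushE.
Qed.

End Renaming.

(** * Closure properties of definable predicates *)

Section DefinablePredicates.
Variables (R : realType) (L : language) (M : structure R L).

Definition valuation I (a : I + R) (e : I -> R) : R :=
  match a with inl i => e i | inr r => r end.

(* Each free variable of the formula stands for a coordinate or a parameter. *)
Definition dfn I (P : (I -> R) -> Prop) : Prop :=
  exists (p : formula L) (s : nat -> I + R),
    forall e, P e <-> sat M (fun k => valuation (s k) e) p.

(** Phrased for functions of the valuation, so that definability of a predicate written as a plain
    proposition can be proved by following its shape. *)
Definition coordinate I (a : (I -> R) -> R) : Prop :=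
  exists c : I + R, forall e, a e = valuation c e.

Lemma coordinate_var I (i : I) : coordinate (fun e => e i).
Proof. by exists (inl i). Qed.

Lemma coordinate_cst I (r : R) : coordinate (fun _ : I -> R => r).
Proof. by exists (inr r). Qed.

Lemma dfn_iff I (P Q : (I -> R) -> Prop) :
  (forall e, P e <-> Q e) -> dfn P -> dfn Q.
Proof. by move=> PQ [p [s ps]]; exists p, s => e; rewrite -PQ. Qed.

Lemma dfn_comp I J (P : (J -> R) -> Prop) (a : (I -> R) -> J -> R) :
  dfn P -> (forall j, coordinate (fun e => a e j)) -> dfn (fun e => P (a e)).
Proof.
move=> [p [s ps]] /choice[c ac].
exists p, (fun k => match s k with inl j => c j | inr r => inr r end) => e.
rewrite ps (_ : (fun k => _) = fun k => valuation
  (match s k with inl j => c j | inr r => inr r end) e) //.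
by apply/funext => k; case: (s k) => //= j; rewrite ac.
Qed.

Lemma dfn_lt I (a b : (I -> R) -> R) :
  coordinate a -> coordinate b -> dfn (fun e => a e < b e).
Proof.
move=> [c ac] [d bd]; exists (Lt (Var L 0) (Var L 1)).
by exists (fun k => if k is 0%N then c else d) => e /=; rewrite ac bd.
Qed.

Lemma dfn_eq I (a b : (I -> R) -> R) :
  coordinate a -> coordinate b -> dfn (fun e => a e = b e).
Proof.
move=> [c ac] [d bd]; exists (Eq (Var L 0) (Var L 1)).
by exists (fun k => if k is 0%N then c else d) => e /=; rewrite ac bd.
Qed.

Lemma dfn_not I (P : (I -> R) -> Prop) : dfn P -> dfn (fun e => ~ P e).
Proof. by move=> [p [s ps]]; exists (Not p), s => e /=; rewrite ps. Qed.

Lemma dfn_and I (P Q : (I -> R) -> Prop) :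
  dfn P -> dfn Q -> dfn (fun e => P e /\ Q e).
Proof.
move=> [p [s ps]] [q [t qt]].
(* Even and odd variables keep the assignments of the two formulas apart. *)
exists (And (rename double p) (rename (fun k => k.*2.+1) q)).
exists (fun k => if odd k then t k./2 else s k./2) => e /=.
rewrite !sat_rename ps qt /comp.
rewrite (_ : (fun k => valuation (s k) e) = fun k => valuation
  (if odd k.*2 then t k.*2./2 else s k.*2./2) e); last first.
  by apply/funext => k; rewrite odd_double doubleK.
rewrite (_ : (fun k => valuation (t k) e) = fun k => valuation
  (if odd k.*2.+1 then t k.*2.+1./2 else s k.*2.+1./2) e) //.
by apply/funext => k; rewrite oddS odd_double /= uphalf_double.
Qed.

Lemma dfn_between I (a b c : (I -> R) -> R) :
  coordinate a -> coordinate b -> coordinate c -> dfn (fun e => a e < b e < c e).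
Proof.
move=> ca cb cc; apply: dfn_iff (dfn_and (dfn_lt ca cb) (dfn_lt cb cc)) => e.
by split=> [[-> ->]|/andP].
Qed.

Lemma dfn_cst I (P : Prop) : dfn (fun _ : I -> R => P).
Proof.
have true_dfn : dfn (fun e : I -> R => (0 : R) = 0).
  exact: dfn_eq (coordinate_cst _ _) (coordinate_cst _ _).
have [/propT ->|/propF ->] := pselect P.
  by apply: dfn_iff true_dfn => e; split.
by apply: dfn_iff (dfn_not true_dfn) => e; split => // /(_ erefl).
Qed.

Lemma dfn_imp I (P Q : (I -> R) -> Prop) :
  dfn P -> dfn Q -> dfn (fun e => P e -> Q e).
Proof.
move=> dP dQ; apply: dfn_iff (dfn_not (dfn_and dP (dfn_not dQ))) => e.
split=> [nPQ Pe|PQ [Pe]]; last by apply; apply: PQ.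
by apply: contrapT => nQ; apply: nPQ.
Qed.

Lemma dfn_all I (P : R -> (I -> R) -> Prop) :
  dfn (fun e : option I -> R => P (e None) (fun i => e (Some i))) ->
  dfn (fun e => forall x, P x e).
Proof.
move=> [p [s ps]].
(* Several variables of [p] may stand for the quantified coordinate; all of them become the bound
   variable 0, so the default [inr 0] below is never read. *)
exists (All (rename (fun k => if s k is inl None then 0%N else k.+1) p)).
exists (fun k => match s k with
  | inl (Some i) => inl i | inl None => inr 0 | inr r => inr r end) => e /=.
have Psat x : P x e <-> sat M (fun k => valuation (s k) (oapp e x)) p.
  exact: (ps (oapp e x)).
split=> Pe x; have := Pe x; rewrite Psat sat_rename.
all: rewrite (_ : _ \o _ = fun k => valuation (s k) (oapp e x)) //.
all: by apply/funext => k /=; case E: (s k) => [[i|]|r] //=; rewrite E.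
Qed.

Lemma dfn_forall_in I (J : eqType) (s : seq J) (P : J -> (I -> R) -> Prop) :
  (forall j, dfn (P j)) -> dfn (fun e => forall j, j \in s -> P j e).
Proof.
move=> dP; elim: s => [|j s IH].
  by apply: dfn_iff (dfn_cst _ True) => e; split.
apply: dfn_iff (dfn_and (dP j) IH) => e; split=> [[Pj Ps] k|Pjs].
  by rewrite inE => /predU1P[->|/Ps].
by split=> [|k ks]; apply: Pjs; rewrite inE ?eqxx ?ks ?orbT.
Qed.

Lemma dfn_forall_fin I (J : finType) (P : J -> (I -> R) -> Prop) :
  (forall j, dfn (P j)) -> dfn (fun e => forall j, P j e).
Proof.
move=> dP; apply: dfn_iff (dfn_forall_in (enum J) dP) => e.
by split=> H j => [|_]; apply: H; rewrite mem_enum.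
Qed.

Lemma dfn_all_block I (J : finType) (P : (J -> R) -> (I -> R) -> Prop) :
  dfn (fun e : I + J -> R => P (fun j => e (inr j)) (fun i => e (inl i))) ->
  dfn (fun e => forall z, P z e).
Proof.
move=> dP.
(* The coordinates in [s] are already quantified, the others are still read from [e]; each induction
   step quantifies one more. *)
have all_on (s : seq J) : dfn (fun e : I + J -> R => forall z : J -> R,
    P (fun j => if j \in s then z j else e (inr j)) (fun i => e (inl i))).
  elim: s => [|j s IH]; first by apply: dfn_iff dP => e; split=> // /(_ (fun=> 0)).
  apply: dfn_iff (dfn_all (P := fun x (e : I + J -> R) => forall z : J -> R,
    P (fun k => if k \in s then z k else if k == j then x else e (inr k))
      (fun i => e (inl i))) _); last first.
    apply: (dfn_comp (a := fun (e : option (I + J) -> R) (k : I + J) =>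
      match k with inl i => e (Some (inl i))
      | inr k => if k == j then e None else e (Some (inr k)) end) IH).
    move=> [i|k]; first exact: coordinate_var.
    by case: (k == j); exact: coordinate_var.
  move=> e; split=> [Pe z|Pe x z]; last first.
    rewrite (_ : (fun k => _) = fun k => if k \in j :: s
      then (if k \in s then z k else x) else e (inr k)); first exact: Pe.
    by apply/funext => k; rewrite inE; case: (k \in s); case: (k == j).
  rewrite (_ : (fun k => _) = fun k => if k \in s then z k
    else if k == j then z j else e (inr k)); first exact: Pe.
  by apply/funext => k; rewrite inE; case: eqVneq => [->|]; case: (_ \in s).
apply: dfn_iff (dfn_comp (a := fun (e : I -> R) (k : I + J) =>
  match k with inl i => e i | inr _ => 0 end) (all_on (enum J)) _); last first.
  by move=> [i|j]; [exact: coordinate_var|exact: coordinate_cst].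
move=> e.
by split=> Pe z; have := Pe z; rewrite (_ : (fun j => _) = z) //;
  apply/funext => j; rewrite mem_enum.
Qed.

Lemma dfn_ex I (P : R -> (I -> R) -> Prop) :
  dfn (fun e : option I -> R => P (e None) (fun i => e (Some i))) ->
  dfn (fun e => exists x, P x e).
Proof.
move=> dP; apply: dfn_iff (dfn_not (dfn_all (P := fun x e => ~ P x e) _)).
  by move=> e; rewrite -existsNP; split=> -[x]; exists x => //; apply: contrapT.
exact: dfn_not.
Qed.

Lemma dfn_ex_block I (J : finType) (P : (J -> R) -> (I -> R) -> Prop) :
  dfn (fun e : I + J -> R => P (fun j => e (inr j)) (fun i => e (inl i))) ->
  dfn (fun e => exists z, P z e).
Proof.
move=> dP; apply: dfn_iff (dfn_not (dfn_all_block (P := fun x e => ~ P x e) _)).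
  by move=> e; rewrite -existsNP; split=> -[x]; exists x => //; apply: contrapT.
exact: dfn_not.
Qed.

Lemma definable_dfn n (X : set 'rV[R]_n) :
  definable M X -> dfn (fun e : 'I_n -> R => X (\row_i e i)).
Proof.
move=> [p [c ->]].
exists p, (fun k => if insub k is Some i then inl i else inr (c (k - n)%N)) => e /=.
rewrite (_ : env _ _ = fun k => valuation
  (if insub k is Some i then inl i else inr (c (k - n)%N)) e) //.
by apply/funext => k; rewrite /env; case: insubP => //= i; rewrite mxE.
Qed.

Lemma dfn_definable n (P : ('I_n -> R) -> Prop) :
  dfn P -> definable M [set x : 'rV[R]_n | P (x ord0)].
Proof.
move=> [p [s ps]].
(* [env] reads parameters from index [n] on, so a variable [k] that stands for a parameter moves to
   [n + k]. *)
exists (rename (fun k => if s k is inl i then val i else (n + k)%N) p).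
exists (fun k => if s k is inr r then r else 0).
apply/seteqP; split=> x /=; rewrite sat_rename ps /comp.
all: rewrite (_ : (fun k => env _ _ _) = fun k => valuation (s k) (x ord0)) //.
all: apply/funext => k; rewrite /env; case E: (s k) => [i|r] /=.
1,3: by rewrite valK.
all: by rewrite insubF ?addKn ?E // ltnNge leq_addr.
Qed.

Lemma definable_map_dfn m n (X : set 'rV[R]_m) (f : 'rV[R]_m -> 'rV[R]_n) :
  definable_map M X f ->
  dfn (fun e : 'I_m + 'I_n -> R =>
    X (\row_i e (inl i)) /\ f (\row_i e (inl i)) = \row_j e (inr j)).
Proof.
move=> /definable_dfn dG.
have := dfn_comp (a := fun (e : 'I_m + 'I_n -> R) k => e (fintype.split k)) dG.
move=> /(_ (fun k => coordinate_var _)); apply: dfn_iff => e.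
have -> : \row_k e (fintype.split k) =
    row_mx (\row_i e (inl i)) (\row_j e (inr j)).
  by apply/rowP => k; rewrite !mxE; case: (fintype.split k) => i; rewrite mxE.
split=> [[x Xx /eq_row_mx[<- <-]] //|[Xx <-]].
by exists (\row_i e (inl i)).
Qed.

Lemma dfn_definable_map m n (X : set 'rV[R]_m) (f : 'rV[R]_m -> 'rV[R]_n) :
  dfn (fun e : 'I_m + 'I_n -> R =>
    X (\row_i e (inl i)) /\ f (\row_i e (inl i)) = \row_j e (inr j)) ->
  definable_map M X f.
Proof.
move=> dG.
have /dfn_definable : dfn (fun e : 'I_(m + n) -> R =>
    X (\row_i e (lshift n i)) /\ f (\row_i e (lshift n i)) = \row_j e (rshift m j)).
  apply: (dfn_comp (a := fun (e : 'I_(m + n) -> R) (k : 'I_m + 'I_n) =>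
    match k with inl i => e (lshift n i) | inr j => e (rshift m j) end) dG).
  by case=> i; exact: coordinate_var.
rewrite /definable_map; set Y := [set x | _]; set G := [set _ | _ in _].
suff -> : Y = G by [].
apply/seteqP; split=> [x /= [Xx fx]|_ [x Xx <-] /=].
  exists (\row_i x ord0 (lshift n i)) => //; rewrite fx.
  by apply/rowP => k; rewrite -(splitK k); case: (fintype.split k) => i /=;
    rewrite ?row_mxEl ?row_mxEr mxE.
rewrite /Y /=; have -> : \row_i row_mx x (f x) ord0 (lshift n i) = x.
  by apply/rowP => i; rewrite mxE row_mxEl.
by split=> //; apply/rowP => j; rewrite mxE row_mxEr.
Qed.

End DefinablePredicates.

Ltac solve_coordinate :=
  first [exact: coordinate_var | exact: coordinate_cst].

(** Recursion on the shape of the predicate; the last case substitutes coordinates or constants into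
    a predicate whose definability is a hypothesis. *)
Ltac solve_dfn :=
  repeat (intros; lazy beta; first
    [ assumption
    | apply: dfn_cst
    | apply: dfn_between; solve_coordinate
    | apply: dfn_lt; solve_coordinate
    | apply: dfn_eq; solve_coordinate
    | apply: dfn_and | apply: dfn_not
    | apply: dfn_ex | apply: dfn_ex_block
    | apply: dfn_all | apply: dfn_all_block
    | apply: dfn_forall_in
    | apply: dfn_imp
    | match goal with dX : dfn _ _ |- _ =>
        apply: (dfn_comp dX); intros; lazy beta; solve_coordinate end ]).

(** * Definable subsets of the line *)

Section OneDimension.
Variables (R : realType) (L : language) (M : structure R L).

Lemma rat_between (a b : R) : a < b -> exists q : rat, a < ratr q < b.
Proof. by move=> /rat_in_itvoo[q]; rewrite in_itv /=; exists q. Qed.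

Lemma open_interval_rat (J : set R) (t : R) : open_interval J -> J t ->
  exists q1 q2 : rat, ratr q1 < t < ratr q2 /\
    forall x, ratr q1 < x < ratr q2 -> J x.
Proof.
move=> [_ [a [b ->]]] /= /andP[lt_at lt_tb].
have [q1 [q1t aq1]] : exists q : rat, ratr q < t /\ (a <= (ratr q)%:E)%E.
  case: a lt_at => [r| |] //; rewrite ?lte_fin => rt.
    by have [q /andP[rq qt]] := rat_between rt; exists q; rewrite lee_fin ltW.
  have [q /andP[_ qt]] : exists q : rat, t - 1 < ratr q < t.
    by apply: rat_between; rewrite gtrBl.
  by exists q; rewrite leNye.
have [q2 [q2t bq2]] : exists q : rat, t < ratr q /\ ((ratr q)%:E <= b)%E.
  case: b lt_tb => [r| |] //; rewrite ?lte_fin => rt.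
    by have [q /andP[rq qt]] := rat_between rt; exists q; rewrite lee_fin ltW.
  have [q /andP[qt _]] : exists q : rat, t < ratr q < t + 1.
    by apply: rat_between; rewrite ltrDl.
  by exists q; rewrite leey.
exists q1, q2; rewrite q1t q2t; split=> // x /andP[q1x xq2].
by rewrite (le_lt_trans aq1) ?lte_fin // (lt_le_trans _ bq2) ?lte_fin.
Qed.

(** A countable set has Lebesgue measure 0, an interval with [a < b] does not. *)
Lemma interval_not_countable (a b : R) (A : set R) : a < b -> countable A ->
  exists2 t, a < t < b & ~ A t.
Proof.
move=> ab cA; apply: contrapT => nA.
have abA : `]a, b[ `<=` A.
  move=> t /=; rewrite in_itv /= => abt.
  by apply: contrapT => nAt; apply: nA; exists t.
have := countable_lebesgue_measure0 (card_le_trans (subset_card_le abA) cA).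
rewrite lebesgue_measure_itv /= lte_fin ab -EFinB => -[] /eqP.
by rewrite subr_eq0 gt_eqF.
Qed.

(** Rational endpoints keep families indexed by intervals countable, as [fat_cover] requires. *)
Definition contains_interval (T : set R) (q : rat * rat) : Prop :=
  ratr q.1 < ratr q.2 :> R /\ forall t, ratr q.1 < t < ratr q.2 -> T t.

Definition isolates (T : set R) (q : rat * rat) (t : R) : Prop :=
  ratr q.1 < t < ratr q.2 /\ forall x, ratr q.1 < x < ratr q.2 -> T x -> x = t.

Hypothesis lomM : locally_o_minimal M.

(** Near [t] the set is a finite union of points and intervals; containing no interval, it is finite
    there. Removing [t] leaves a closed set, which avoids a neighborhood of [t]. *)
Lemma isolated_point (T : set R) (t : R) :
  dfn M (fun e : unit -> R => T (e tt)) ->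
  (forall q, ~ contains_interval T q) -> T t -> exists q, isolates T q t.
Proof.
move=> dT noint Tt.
have /lomM/(_ t)[I [oI It [F [finF FJ TI]]]] :
    definable M [set x : 'rV[R]_1 | T (x ord0 ord0)].
  apply: (dfn_definable (P := fun e => T (e ord0))).
  by apply: (dfn_comp (a := fun e _ => e ord0) dT) => _; exact: coordinate_var.
have finTI : finite_set (T `&` I).
  rewrite TI; apply: bigcup_finite => // J FJJ.
  have [[x ->]|oJ] := FJ _ FJJ; first exact: finite_set1.
  have [x Jx] := oJ.1; have [q1 [q2 [/andP[q1x xq2] qJ]]] := open_interval_rat oJ Jx.
  exfalso; apply: (noint (q1, q2)); split=> [|y /qJ Jy]; first exact: lt_trans xq2.
  by have [] : (T `&` I) y by rewrite TI; exists J.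
have [q1 [q2 [/andP[q1t tq2] qI]]] := open_interval_rat oI It.
have : closed ((T `&` I) `\ t).
  apply: (accessible_finite_set_closed.1 (hausdorff_accessible (@Rhausdorff R))).
  exact: finite_setD.
move=> /closed_openC; rewrite openE => /(_ t) /= [|e /= e0 te].
  by case=> _; apply.
have [r1 /andP[+ r1t]] : exists q : rat, Num.max (ratr q1) (t - e) < ratr q < t.
  by apply: rat_between; rewrite gt_max q1t gtrBl.
have [r2 /andP[tr2]] : exists q : rat, t < ratr q < Num.min (ratr q2) (t + e).
  by apply: rat_between; rewrite lt_min tq2 ltrDl.
rewrite lt_min gt_max => /andP[r2q2 r2e] /andP[q1r1 er1].
exists (r1, r2); rewrite /isolates /= r1t tr2; split=> // x /andP[r1x xr2] Tx.
apply: contrapT => xt; apply: (te x) => /=.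
  by rewrite ltr_distlC (lt_trans er1 r1x) (lt_trans xr2 r2e).
split=> //; split=> //; apply: qI.
by rewrite (lt_trans q1r1 r1x) (lt_trans xr2 r2q2).
Qed.

(** A point of [T] is determined by a rational interval that isolates it. *)
Lemma countable_of_no_interval (T : set R) :
  dfn M (fun e : unit -> R => T (e tt)) ->
  (forall q, ~ contains_interval T q) -> countable T.
Proof.
move=> dT noint.
have /choice[q qP] t : exists q, T t -> isolates T q t.
  have [Tt|nTt] := pselect (T t); last by exists (0, 0).
  by have [q] := isolated_point dT noint Tt; exists q.
apply/countable_injP; exists (pickle \o q) => s t; rewrite !inE => Ts Tt.
move=> /(pcan_inj (@pickleK _)) qst.
by apply: (qP t Tt).2 => //; rewrite -qst; exact: (qP s Ts).1.
Qed.

End OneDimension.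

(** * Boxes, fibers and projections with nonempty interior *)

Section Boxes.
Variables (R : realType) (V : finType).
Implicit Types (U : seq V) (X : set (V -> R)) (l u y z : V -> R).

Definition in_box U l u y : Prop := forall i, i \in U -> l i < y i < u i.

Definition agree U z y : Prop := forall i, i \in U -> z i = y i.

(* The projection of X to the coordinates in U has nonempty interior. *)
Definition fat U X : Prop :=
  exists l u, (forall i, l i < u i) /\
    forall y, in_box U l u y -> exists2 z, X z & agree U z y.

Definition fiber U w X y : set R :=
  fun t => exists z, X z /\ agree U z y /\ z w = t.

Lemma box_point l u : (forall i, l i < u i) -> exists y, forall i, l i < y i < u i.
Proof.
by move=> lu; exists (fun i => (l i + u i) / 2) => i; rewrite !midf_lt.
Qed.

Lemma in_box_agree U l u y z : agree U z y -> in_box U l u y -> in_box U l u z.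
Proof. by move=> zy by_ i iU; rewrite zy //; exact: by_. Qed.

Lemma fat_nonempty U X : fat U X -> X !=set0.
Proof.
move=> [l [u [/box_point[y ly] H]]].
by have [|z Xz _] := H y; [move=> i _; exact: ly|exists z].
Qed.

Lemma fat_sub U X Y : X `<=` Y -> fat U X -> fat U Y.
Proof.
move=> XY [l [u [lu H]]]; exists l, u; split=> // y /H[z Xz zy].
by exists z => //; exact: XY.
Qed.

Lemma fat_eq_mem U U' X : U =i U' -> fat U X -> fat U' X.
Proof.
move=> UU' [l [u [lu H]]]; exists l, u; split=> // y yU.
have [|z Xz zy] := H y; first by move=> i; rewrite UU'; exact: yU.
by exists z => // i; rewrite -UU'; exact: zy.
Qed.

Lemma fiber_agree U w X y z : agree U z y -> fiber U w X z = fiber U w X y.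
Proof.
move=> zy; apply/seteqP; split=> t [v [Xv [vy vw]]]; exists v; split=> //.
all: by split=> // i iU; rewrite vy // zy.
Qed.

(** The interval [q] is the same over a whole box in the coordinates [U], so the product of that box
    with [q] lies in the projection to [s :: U]. *)
Lemma fat_cons U s X q : s \notin U ->
  fat U (fun y => contains_interval (fiber U s X y) q) -> fat (s :: U) X.
Proof.
move=> sU fatU; have [_ [q12 _]] := fat_nonempty fatU.
have [l [u [lu H]]] := fatU.
exists (fun i => if i == s then ratr q.1 else l i).
exists (fun i => if i == s then ratr q.2 else u i); split=> [i|y ybox].
  by case: ifP.
have [|z [_ zq] zy] := H y.
  move=> i iU; have := ybox i; rewrite inE iU orbT => /(_ isT).
  by case: eqP iU sU => // -> ->.
have [|v [Xv [vz vs]]] := zq (y s).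
  by have := ybox s; rewrite inE eqxx => /(_ isT).
exists v => // i; rewrite inE => /predU1P[->//|iU].
by rewrite vz // zy.
Qed.

End Boxes.

(** * Covering, exchange and continuity for definable sets *)

Section Fatness.
Variables (R : realType) (L : language) (M : structure R L).
Hypothesis lomM : locally_o_minimal M.
Variable V : finType.
Implicit Types (U W : seq V) (X Z : set (V -> R)) (l u y z : V -> R).

Lemma fiber_dfn U w X y : dfn M X -> dfn M (fun e : unit -> R => fiber U w X y (e tt)).
Proof. by move=> dX; rewrite /fiber /agree; solve_dfn. Qed.

Lemma contains_interval_dfn U w X q :
  dfn M X -> dfn M (fun y => contains_interval (fiber U w X y) q).
Proof. by move=> dX; rewrite /contains_interval /fiber /agree; solve_dfn. Qed.

(* By induction on U: over every point of a box in one dimension less, one of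
   the countably many fibers is uncountable, hence contains an interval with
   rational endpoints, and these intervals are again countably many. *)
Lemma fat_cover U (K : countType) (X : K -> set (V -> R)) l u :
  uniq U -> (forall k, dfn M (X k)) -> (forall i, l i < u i) ->
  (forall y, in_box U l u y -> exists k, exists2 z, X k z & agree U z y) ->
  exists k, fat U (X k).
Proof.
elim: U => [|s U IH] in K X *.
  move=> _ _ lu /(_ l)[//|k [z Xz _]]; exists k, l, u; split=> // y _.
  by exists z.
move=> /= /andP[sU uU] dX lu cover.
have [|//||[k q]] := IH _ (fun kq : K * (rat * rat) =>
    fun y => contains_interval (fiber U s (X kq.1) y) kq.2) uU.
- by move=> [k q]; apply: contains_interval_dfn.
- move=> y ybox; apply: contrapT => none.
  have cfib k : countable (fiber U s (X k) y).
    apply: (countable_of_no_interval lomM); first exact: fiber_dfn.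
    by move=> q kq; apply: none; exists (k, q), y.
  (* The union of the fibers over [y] is countable and misses some [t], but the point over [y] with
     [s]-coordinate [t] is covered. *)
  have [t lt_t nt] := interval_not_countable (lu s)
    (bigcup_countable (countableP [set: K]) (fun k _ => cfib k)).
  have [|k [z Xz zy]] := cover (fun i => if i == s then t else y i).
    move=> i; rewrite inE; case: eqP => [-> //|_ /= iU]; exact: ybox.
  apply: nt; exists k => //; exists z; split=> //; split=> [i iU|].
    by rewrite zy ?inE ?iU ?orbT //; case: eqP iU sU => // -> ->.
  by rewrite zy ?inE eqxx.
- by move=> /(fat_cons sU); exists k.
Qed.

(** The coordinate [t] is a function of the finitely many coordinates in [W], each of which takes
    countably many values over [y]. *)
Lemma fiber_countable U W Z y t :
  (forall z z', Z z -> Z z' -> agree W z z' -> z t = z' t) ->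
  (forall s, s \in W -> countable (fiber U s Z y)) -> countable (fiber U t Z y).
Proof.
move=> det cW.
have /choice[c cP] s : exists f : R -> nat,
    s \in W -> {in fiber U s Z y &, injective f}.
  have [sW|sW] := boolP (s \in W); last by exists (fun=> 0%N).
  by have /countable_injP[f] := cW _ sW; exists f.
have /choice[z zP] a : exists z, fiber U t Z y a ->
    Z z /\ agree U z y /\ z t = a.
  have [[z ?]|na] := pselect (fiber U t Z y a); first by exists z.
  by exists (fun=> 0).
(* A value [a] is coded by the numbers of the [W]-coordinates of a chosen point [z a]; coordinates
   outside [W] get the code 0. *)
apply/countable_injP; exists (fun a => pickle [ffun s => c s (z a s)]) => a b.
rewrite !inE => /zP[Za [ay za]] /zP[Zb [by_ zb]] /(pcan_inj (@pickleK _)) /ffunP E.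
rewrite -za -zb; apply: det => // s sW; apply: (cP s sW).
- by rewrite inE; exists (z a).
- by rewrite inE; exists (z b).
- by have := E s; rewrite !ffunE.
Qed.

(** If over each point of the box some fiber along a coordinate in [W] outside [U] contains an
    interval, [fat_cover] makes the coordinate and the interval uniform. Otherwise some [y] has
    countable fibers along all of [W], hence along [t], where the fiber contains an interval. *)
Lemma fat_exchange U W Z t : uniq U -> t \notin U -> dfn M Z ->
  (forall z z', Z z -> Z z' -> agree W z z' -> z t = z' t) ->
  fat (t :: U) Z -> exists s, [/\ s \in W, s \notin U & fat (s :: U) Z].
Proof.
move=> uU tU dZ det [l [u [lu H]]].
pose X (k : V * (rat * rat)) : set (V -> R) := fun y =>
  (k.1 \in W /\ k.1 \notin U) /\ contains_interval (fiber U k.1 Z y) k.2.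
have [cov|] := pselect (forall y, in_box U l u y -> exists k, X k y).
  have [|y /cov[k Xy]|[s q] fatX] := fat_cover (X := X) uU _ lu.
  - by move=> k; apply: dfn_and; [exact: dfn_cst|exact: contains_interval_dfn].
  - by exists k, y.
  have [_ [[sW sU] _]] := fat_nonempty fatX; exists s; split=> //.
  by apply: (fat_cons (q := q) sU); apply: fat_sub fatX => y [].
move=> /existsNP[y /not_implyP[ybox noX]]; exfalso.
have /(interval_not_countable (lu t))[a la] : countable (fiber U t Z y).
  apply: (fiber_countable det) => s sW.
  (* For [s] in [U] the fiber has at most the point [y s]. *)
  have [sU|sU] := boolP (s \in U).
    apply: (@sub_countable _ _ _ [set y s]); last exact: finite_set_countable.
    by apply: subset_card_le => _ [z [_ [zy <-]]]; exact: zy.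
  apply: (countable_of_no_interval lomM); first exact: fiber_dfn.
  by move=> q sq; apply: noX; exists (s, q).
apply; have [|z Zz zy] := H (fun i => if i == t then a else y i).
  by move=> i; rewrite inE; case: eqP => [->|_ /= /ybox].
exists z; split=> //; split=> [i iU|].
  by rewrite zy ?inE ?iU ?orbT //; case: eqP iU tU => // -> ->.
by rewrite zy ?inE eqxx.
Qed.

(** The coordinates replacing those of [T] accumulate in [U], which is therefore general in the
    induction. *)
Lemma fat_exchange_all U W Z T : uniq (T ++ U) -> {subset U <= W} -> dfn M Z ->
  (forall t z z', t \in T -> Z z -> Z z' -> agree W z z' -> z t = z' t) ->
  fat (T ++ U) Z ->
  exists U', [/\ uniq U', {subset U' <= W}, size U' = (size T + size U)%N & fat U' Z].
Proof.
elim: T => [|t T IH] in U *; first by exists U.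
move=> /= /andP[tTU uTU] UW dZ det fatZ.
have [|s [sW sTU fats]] := fat_exchange (W := W) uTU tTU dZ _ fatZ.
  by move=> z z'; apply: det; rewrite inE eqxx.
have perm : perm_eq (T ++ s :: U) (s :: T ++ U) by rewrite -cat1s perm_catCA.
have [||//|||U' [uU' U'W sizeU' fatU']] := IH (s :: U).
- by rewrite (perm_uniq perm) /= sTU.
- by move=> i; rewrite inE => /predU1P[->|/UW].
- by move=> t' z z' t'T; apply: det; rewrite inE t'T orbT.
- by apply: fat_eq_mem fats => i; rewrite (perm_mem perm).
by exists U'; rewrite addSnnS.
Qed.

Definition locally_in U w X z (a b : R) : Prop :=
  exists l u, in_box U l u z /\
    forall z', X z' -> in_box U l u z' -> a < z' w < b.

(* On X, the coordinate w is a continuous function of the coordinates in U. *)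
Definition continuous_coord U w X : Prop :=
  forall z, X z -> forall a b, a < z w < b -> locally_in U w X z a b.

Lemma continuous_coord_sub U w X Y :
  X `<=` Y -> continuous_coord U w Y -> continuous_coord U w X.
Proof.
move=> XY cY z /XY Yz a b /(cY _ Yz)[l [u [zlu H]]].
by exists l, u; split=> // z' /XY; exact: H.
Qed.

(** Otherwise continuity at [z] with radius [|z w - z' w|] applies to [z'], which lies in every
    [U]-box around [z], and makes this distance smaller than itself. *)
Lemma continuous_coordP U w X z z' : continuous_coord U w X ->
  X z -> X z' -> agree U z z' -> z w = z' w.
Proof.
move=> cX Xz Xz' zz'; apply/eqP; apply: contrapT => /negP neq.
have lt0 : 0 < `|z w - z' w| by rewrite normr_gt0 subr_eq0.
have [|l [u [zlu H]]] := cX z Xz (z w - `|z w - z' w|) (z w + `|z w - z' w|).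
  by rewrite gtrBl lt0 ltrDl.
have := H z' Xz'; rewrite -ltr_distlC distrC ltxx => /(_ _)/negP; apply=> //.
by move=> i iU; rewrite -zz' //; exact: zlu.
Qed.

(** [Some None] carries [a] and [None] carries [b], so that the bounds can be quantified or
    specialized to rationals. *)
Lemma locally_in_dfn U w X : dfn M X ->
  dfn M (fun e : option (option V) -> R =>
    locally_in U w X (fun i => e (Some (Some i))) (e (Some None)) (e None)).
Proof. by move=> dX; rewrite /locally_in /in_box; solve_dfn. Qed.

Lemma fat_continuous_of_function U w X : uniq U -> dfn M X -> fat U X ->
  (forall z z', X z -> X z' -> agree U z z' -> z w = z' w) ->
  exists Y, [/\ Y `<=` X, dfn M Y, fat U Y & continuous_coord U w Y].
Proof.
move=> uU dX [l [u [lu H]]] fun_w; have dloc := locally_in_dfn U w dX.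
(* [None] collects the points of continuity, [Some q] those where continuity fails for the rational
   interval [q]. *)
pose Y (k : option (rat * rat)) : set (V -> R) := fun z => X z /\
  if k is Some q then ratr q.1 < z w < ratr q.2 /\
    ~ locally_in U w X z (ratr q.1) (ratr q.2)
  else forall a b, a < z w < b -> locally_in U w X z a b.
have [|y ylu|[q|] fatY] := fat_cover (X := Y) uU _ lu.
- case=> [q|]; apply: dfn_and => //.
    apply: dfn_and; first by solve_dfn.
    apply: dfn_not; apply: (dfn_comp (a := fun (e : V -> R) k => match k with
      Some (Some i) => e i | Some None => ratr q.1 | None => ratr q.2 end) dloc).
    by move=> [[i|]|]; solve_coordinate.
  solve_dfn.
- have [z Xz zy] := H y ylu.
  have [Yz|] := pselect (Y None z); first by exists None, z.
  move=> /not_andP[//|/existsNP[a /existsNP[b /not_implyP[/andP[az zb] nloc]]]].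
  have [q1 /andP[aq1 q1z]] := rat_between az.
  have [q2 /andP[zq2 q2b]] := rat_between zb.
  exists (Some (q1, q2)), z => //; split=> //=; rewrite q1z zq2; split=> //.
  move=> [l' [u' [zl'u' H']]]; apply: nloc; exists l', u'; split=> // z' Xz' z'lu.
  have /andP[q1z' z'q2] := H' _ Xz' z'lu.
  by rewrite (lt_trans aq1 q1z') (lt_trans z'q2 q2b).
(* Over a box in the projection of this piece, every point of [X] has the same [w] as a point of the
   piece, hence a value in [q]; that box then contradicts the failure of continuity. *)
- exfalso; have [l' [u' [lu' H']]] := fatY.
  have [y ylu] := box_point lu'.
  have [|z [Xz [zq nloc]] zy] := H' y; first by move=> i _; exact: ylu.
  apply: nloc; exists l', u'; split=> [|z' Xz' /H'[v [Xv [vq _]] vz']].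
    by apply: in_box_agree zy _ => i _; exact: ylu.
  by rewrite -(fun_w _ _ Xv Xz' vz').
- exists (Y None); split=> //.
  + by move=> z [].
  + by rewrite /Y; apply: dfn_and => //; solve_dfn.
  + move=> z [Xz Yz] a b /Yz[l' [u' [zlu H']]].
    by exists l', u'; split=> // z' [Xz' _]; exact: H'.
Qed.

Lemma fat_continuous_step U w X : uniq U -> dfn M X -> fat U X ->
  exists Y, [/\ Y `<=` X, dfn M Y, fat U Y & continuous_coord U w Y].
Proof.
move=> uU dX [l [u [lu H]]].
(* With [true] the fiber contains the interval [q]; with [false] it has exactly one point in [q]. *)
pose Y (k : bool * (rat * rat)) : set (V -> R) := fun y =>
  if k.1 then contains_interval (fiber U w X y) k.2
  else exists t, fiber U w X y t /\ isolates (fiber U w X y) k.2 t.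
have [|y ylu|[[] q] [l' [u' [lu' H']]]] := fat_cover (X := Y) uU _ lu.
- case=> [[] q]; first exact: contains_interval_dfn.
  by rewrite /Y /fiber /isolates /agree /=; solve_dfn.
- have [z Xz zy] := H y ylu.
  have [[q int]|noint] := pselect (exists q, contains_interval (fiber U w X y) q).
    by exists (true, q), y.
  have fz : fiber U w X y (z w) by exists z.
  have [|q isoq] := isolated_point lomM (fiber_dfn U w y dX) _ fz.
    by move=> q int; apply: noint; exists q.
  by exists (false, q), y => //; exists (z w).
(* All fibers over the box contain the midpoint [r] of [q], so [w] can be made constant. *)
- pose r : R := (ratr q.1 + ratr q.2) / 2.
  exists (fun z => X z /\ z w = r); split.
  + by move=> z [].
  + by apply: dfn_and => //; solve_dfn.
  + exists l', u'; split=> // y /H'[z [q12 zq] zy].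
    have [|v [Xv [vz vr]]] := zq r; first by rewrite !midf_lt.
    by exists v => // i iU; rewrite vz // zy.
  + move=> z [Xz ->] a b rab; exists (fun i => z i - 1), (fun i => z i + 1).
    by split=> [i _|z' [_ ->] //]; rewrite gtrBl ltrDl ltr01.
(* Restricting [w] to the isolating interval makes it a function of the coordinates in [U]. *)
- pose Z z := X z /\ (ratr q.1 < z w < ratr q.2 /\
    exists t, isolates (fiber U w X z) q t).
  have [||z z'|A [AZ dA fatA cA]] := @fat_continuous_of_function U w Z uU.
  + by rewrite /Z /fiber /isolates /agree; solve_dfn.
  + exists l', u'; split=> // y /H'[z [t [[v [Xv [vz <-]]] [tq iso]]] zy].
    exists v => [|i iU]; last by rewrite vz // zy.
    split=> //; split=> //; exists (v w).
    by rewrite (fiber_agree _ _ vz); split.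
  + move=> [Xz [zq [t [_ iso]]]] [Xz' [z'q _]] zz'.
    have -> : z w = t by apply: iso => //; exists z; split=> //; split.
    apply/esym; apply: iso => //; exists z'.
    by split=> //; split=> // i iU; rewrite zz'.
  by exists A; split=> // z /AZ[].
Qed.

(** One coordinate is treated at a time; continuity of the earlier ones survives shrinking the
    set. *)
Lemma fat_continuous U X : uniq U -> dfn M X -> fat U X ->
  exists Y, [/\ Y `<=` X, dfn M Y, fat U Y & forall w, continuous_coord U w Y].
Proof.
move=> uU dX fatX.
have [Y [YX dY fatY cY]] : exists Y, [/\ Y `<=` X, dfn M Y, fat U Y &
    forall w, w \in enum V -> continuous_coord U w Y].
  elim: (enum V) => [|w W [Y [YX dY fatY cY]]].
    by exists X; split=> //; exact: subset_refl.
  have [Z [ZY dZ fatZ cZ]] := fat_continuous_step w uU dY fatY.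
  exists Z; split=> // [z /ZY/YX //|w']; rewrite inE => /predU1P[->//|/cY].
  exact: continuous_coord_sub.
by exists Y; split=> // w; apply: cY; rewrite mem_enum.
Qed.

End Fatness.

(** * Embedding a box into a set with a fat projection *)

Section Embedding.
Variables (R : realType) (L : language) (M : structure R L).
Hypothesis lomM : locally_o_minimal M.

Lemma row_cvg T (F : set_system T) n (f : T -> 'rV[R]_n) (a : 'rV[R]_n) :
  Filter F ->
  (forall j (b c : R), b < a ord0 j < c -> \forall x \near F, b < f x ord0 j < c) ->
  f @ F --> a.
Proof.
move=> FF H; apply/cvg_ballP => e e0.
have H' j : \forall x \near F, ball (a ord0 j) e (f x ord0 j).
  apply: filterS (H j (a ord0 j - e) (a ord0 j + e) _).
    by move=> x; rewrite -ltr_distlC.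
  by rewrite gtrBl ltrDl e0.
apply: filterS (filter_forall FF H') => x Hx; split=> // i j.
by rewrite [i]ord1; exact: Hx.
Qed.

Lemma near_coord_between n (y : 'rV[R]_n) j (b c : R) : b < y ord0 j < c ->
  nbhs y [set x : 'rV[R]_n | b < x ord0 j < c].
Proof.
move=> ybc; have : y ord0 j \in `]b, c[ by rewrite in_itv.
by move=> /near_in_itvoo /(@coord_continuous _ _ _ ord0 j y).
Qed.

(** Once all coordinates are continuous in those of [U], the set is over a box the graph of a
    continuous map, which the projection to [U] inverts. *)
Lemma fat_embeds_box m d (X : set 'rV[R]_m) (U : d.-tuple 'I_m) :
  definable M X -> uniq U -> fat U (fun e => X (\row_i e i)) -> embeds_box M X d.
Proof.
move=> /definable_dfn dX uU fatX.
have [Y [YX dY [l [u [lu H]]] cY]] := fat_continuous lomM uU dX fatX.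
pose s := tnth U; have inj_s : injective s by apply/tuple_uniqP.
pose B := [set y : 'rV[R]_d | forall i, l (s i) < y ord0 i < u (s i)].
have agreeP (z z' : 'I_m -> R) : agree U z z' <-> forall i, z (s i) = z' (s i).
  by split=> [zz' i|zz' _ /tnthP[i ->]] //; apply: zz'; exact: mem_tnth.
have /choice[F FP] y : exists z, B y -> Y z /\ forall i, z (s i) = y ord0 i.
  have [By|nBy] := pselect (B y); last by exists (fun=> 0).
  (* [v] extends [y] by 0 to the coordinates outside [U]. *)
  have /choice[v vP] j : exists r, forall i, s i = j -> r = y ord0 i.
    have [[i <-]|no] := pselect (exists i, s i = j).
      by exists (y ord0 i) => i' /inj_s ->.
    by exists 0 => i sij; exfalso; apply: no; exists i.
  have [|z Yz /agreeP zv] := H v; first by move=> _ /tnthP[i ->]; rewrite (vP _ i).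
  by exists z => _; split=> // i; rewrite zv; exact: vP.
have F_unique y z : B y -> Y z -> (forall i, z (s i) = y ord0 i) -> F y = z.
  move=> By Yz zy; have [YF Fy] := FP _ By.
  apply/funext => w; apply: (continuous_coordP (cY w)) => //.
  by apply/agreeP => i; rewrite zy Fy.
exists B, (fun y => \row_j F y j); split.
- exists (fun i => [set x | l (s i) < x < u (s i)]); split=> // i; split.
    by exists ((l (s i) + u (s i)) / 2); rewrite /= !midf_lt.
  by exists (l (s i))%:E, (u (s i))%:E; apply/seteqP; split=> x; rewrite /= !lte_fin.
- apply: dfn_definable_map.
  (* By uniqueness the graph of the chosen [F] is the part of [Y] over the box. *)
  have dG : dfn M (fun e : 'I_d + 'I_m -> R =>
      (forall i, l (s i) < e (inl i) < u (s i)) /\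
      (Y (fun j => e (inr j)) /\ forall i, e (inr (s i)) = e (inl i))).
    apply: dfn_and; first by apply: dfn_forall_fin => i; solve_dfn.
    apply: dfn_and; first by solve_dfn.
    by apply: dfn_forall_fin => i; solve_dfn.
  apply: dfn_iff dG => e.
  have BE : B (\row_i e (inl i)) <-> forall i, l (s i) < e (inl i) < u (s i).
    by split=> Be i; have := Be i; rewrite mxE.
  rewrite BE; split=> [[Be [Ye es]]|[Be Fe]]; split=> //.
    apply/rowP => j; rewrite !mxE (F_unique _ (fun j => e (inr j))) //.
      by rewrite BE.
    by move=> i; rewrite mxE.
  have [YF Fy] := FP _ (BE.2 Be).
  have <- : F (\row_i e (inl i)) = fun j => e (inr j).
    by apply/funext => j; have /rowP/(_ j) := Fe; rewrite !mxE.
  split=> // i; have := Fy i; rewrite mxE => <-.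
  by have /rowP/(_ (s i)) := Fe; rewrite !mxE.
- by move=> _ [y By <-]; apply: YX; have [] := FP _ By.
- split.
    apply/subspace_continuousP => y By; apply: row_cvg => j b c.
    have [YF Fy] := FP _ By; rewrite mxE => /(cY j _ YF)[l' [u' [Flu H']]].
    have : nbhs y [set x : 'rV[R]_d | forall i, l' (s i) < x ord0 i < u' (s i)].
      apply: (filter_forall (nbhs_filter y)) => i; apply: near_coord_between.
      by rewrite -Fy; apply: Flu; exact: mem_tnth.
    rewrite near_withinE; apply: filterS => x xlu Bx; rewrite mxE.
    have [YFx Fx] := FP _ Bx.
    by apply: H' => // _ /tnthP[i ->]; rewrite Fx.
  exists (fun x : 'rV[R]_m => \row_i x ord0 (s i)); split=> [y By|].
    by apply/rowP => i; rewrite !mxE; have [_] := FP _ By.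
  apply: continuous_subspaceT => x; apply: (row_cvg (nbhs_filter x)) => i b c.
  rewrite mxE => /near_coord_between; by apply: filterS => y; rewrite mxE.
Qed.

End Embedding.

(** * Pulling an embedded box back along a definable map *)

Lemma subset_map_inl (A B : finType) (U : seq (A + B)) :
  {subset U <= map inl (enum A)} -> exists V, U = map inl V.
Proof.
elim: U => [|a U IH] sub; first by exists [::].
have /mapP[i _ ->] := sub a (mem_head _ _).
have [|V ->] := IH; first by move=> b bU; apply: sub; rewrite inE bU orbT.
by exists (i :: V).
Qed.

Lemma open_box_contains_box (R : realType) m d (B : set 'rV[R]_d) :
  open_box B -> exists l u : 'I_m + 'I_d -> R, (forall i, l i < u i) /\
    forall y, in_box (map inr (enum 'I_d)) l u y -> B (\row_i y (inr i)).
Proof.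
move=> [J [oJ ->]].
have /choice[q qP] i : exists q : R * R,
    q.1 < q.2 /\ forall x, q.1 < x < q.2 -> J i x.
  have [x Jx] := (oJ i).1.
  have [q1 [q2 [/andP[q1x xq2] qJ]]] := open_interval_rat (oJ i) Jx.
  by exists (ratr q1, ratr q2); split=> //=; exact: lt_trans xq2.
(* The bounds 0 and 1 are fillers for the coordinates not in the box. *)
exists (fun k => match k with inl _ => 0 | inr i => (q i).1 end).
exists (fun k => match k with inl _ => 1 | inr i => (q i).2 end).
split=> [[i|i]|y ybox i]; [exact: ltr01|exact: (qP i).1|].
rewrite mxE; apply: (qP i).2.
by apply: (ybox (inr i)); rewrite map_f // mem_enum.
Qed.

Lemma embeds_box_preimage (R : realType) (L : language) (M : structure R L)
    (m n d : nat) (X : set 'rV[R]_m) (f : 'rV[R]_m -> 'rV[R]_n) :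
  locally_o_minimal M -> definable M X -> definable_map M X f ->
  embeds_box M (f @` X) d -> embeds_box M X d.
Proof.
move=> lomM dX /definable_map_dfn df.
move=> [B [g [oB /definable_map_dfn dg gB [_ [k [gK _]]]]]].
(* The fiber product of [f] and [g]: pairs of [x] in [X] and [y] in [B] with [f x = g y]. *)
pose Z (e : 'I_m + 'I_d -> R) := exists w : 'I_n -> R,
  (X (\row_i e (inl i)) /\ f (\row_i e (inl i)) = \row_j w j) /\
  (B (\row_i e (inr i)) /\ g (\row_i e (inr i)) = \row_j w j).
have dZ : dfn M Z.
  apply: dfn_ex_block; apply: dfn_and.
    apply: (dfn_comp (a := fun (e : 'I_m + 'I_d + 'I_n -> R) (k : 'I_m + 'I_n) =>
      match k with inl i => e (inl (inl i)) | inr j => e (inr j) end) df).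
    by case=> i; exact: coordinate_var.
  apply: (dfn_comp (a := fun (e : 'I_m + 'I_d + 'I_n -> R) (k : 'I_d + 'I_n) =>
    match k with inl i => e (inl (inr i)) | inr j => e (inr j) end) dg).
  by case=> i; exact: coordinate_var.
pose T : seq ('I_m + 'I_d) := map inr (enum 'I_d).
pose W : seq ('I_m + 'I_d) := map inl (enum 'I_m).
have [|||||U [uU UW sizeU fatU]] := @fat_exchange_all R L M lomM _ [::] W Z T => //.
- by rewrite cats0 map_inj_uniq ?enum_uniq // => i j [].
(* The point [x] determines [g y = f x], hence [y], as [k] inverts [g] on [B]. *)
- move=> _ z z' /mapP[j _ ->] [w [[_ fz] [Bz gz]]] [w' [[_ fz'] [Bz' gz']]] zz'.
  have xE : \row_i z (inl i) = \row_i z' (inl i).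
    by apply/rowP => i; rewrite !mxE; apply: zz'; rewrite map_f // mem_enum.
  have : \row_i z (inr i) = \row_i z' (inr i).
    by rewrite -(gK _ Bz) -(gK _ Bz') gz gz' -fz -fz' xE.
  by move=> /rowP/(_ j); rewrite !mxE.
(* [Z] projects onto all of [B] because [g] maps [B] into the image of [X]. *)
- have [l [u [lu lB]]] := open_box_contains_box m oB.
  rewrite cats0; exists l, u; split=> // y /lB By.
  have [x Xx fx] : (f @` X) (g (\row_i y (inr i))) by apply: gB; exists (\row_i y (inr i)).
  exists (fun k => match k with inl i => x ord0 i | inr i => y (inr i) end).
    exists (g (\row_i y (inr i)) ord0) => /=.
    have -> : \row_i x ord0 i = x by apply/rowP => i; rewrite mxE.
    by rewrite fx; split; split=> //; apply/rowP => j; rewrite mxE.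
  by move=> _ /mapP[i _ ->].
have [V UV] := subset_map_inl UW.
rewrite UV map_inj_uniq in uU => [|i j [] //].
have sizeV : size V == d.
  have := congr1 size UV; rewrite sizeU [RHS]size_map [size T]size_map size_enum_ord addn0.
  by move=> <-.
apply: (@fat_embeds_box R L M lomM m d X (Tuple sizeV)) => //.
have [l [u [lu H]]] := fatU.
exists (fun i => l (inl i)), (fun i => u (inl i)); split=> // y ybox.
(* The box coordinates are filled with 0; none of them is in [U]. *)
have [|z [w [[Xz _] _]] zy] :=
    H (fun k => match k with inl i => y i | inr _ => 0 end).
  by rewrite UV => _ /mapP[i iV ->]; exact: ybox.
exists (fun i => z (inl i)) => // i iV.
by rewrite zy // UV map_f.
Qed.

Theorem theorem2p4 (R : realType) (L : language) (M : structure R L)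
    (m n : nat) (X : set 'rV[R]_m) (f : 'rV[R]_m -> 'rV[R]_n) :
  locally_o_minimal M -> definable M X -> definable_map M X f ->
  (dimension M (f @` X) <= dimension M X)%E.
Proof.
move=> lomM dX df; apply: ge_ereal_sup => _ [d /= fXd <-].
by apply: ereal_sup_ubound; exists d => //; exact: embeds_box_preimage df fXd.
Qed.
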